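(* Let $A_k\in\mathbb{S}^\ell$ $(k=0,1,\ldots,m)$, let $D\subseteq\{(i,i):1\le i\le\ell\}$, and let $U\in\mathbb{S}^\ell(D)$. For $\delta\in\mathbb{R}^m$ consider the SDP $$ \eta(\delta,U)=\inf\Big\{\langle A_0,Y\rangle:\ Y\in\mathbb{S}^\ell_+,\ \langle A_k,Y\rangle\le\delta_k\ (k=1,\ldots,m),\ [Y]_{ii}=U_{ii}\ ((i,i)\in D)\Big\}.\qquad(S_\delta) $$ Suppose that, for every $\delta'\in\mathbb{R}^m$, if $-\infty<\eta(\delta',U)<\infty$, then $(S_{\delta'})$ has an optimal solution of rank at most one. Let $\delta\in\mathbb{R}^m$ and $\delta_j\in\mathbb{R}$ $(j=m+1,\ldots,m')$ be fixed, where $m<m'$, and assume that $A_j\in\mathbb{S}^\ell$ satisfies $$ A_j\in\mathrm{cone}\{A_k:k=1,\ldots,m\}\equiv\Big\{\sum_{k=1}^m\alpha_kA_k:\ \alpha_k\ge0\ (k=1,\ldots,m)\Big\}\qquad(j=m+1,\ldots,m'). $$ Then the modified SDP obtained from $(S_\delta)$ by adding the constraints $\langle A_j,Y\rangle\le\delta_j$ $(j=m+1,\ldots,m')$ is exact.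
   Context: $\mathbb{S}^\ell$ is the space of real symmetric $\ell\times\ell$ matrices with inner product $\langle A,B\rangle=\sum_{i,j}[A]_{ij}[B]_{ij}$, and $\mathbb{S}^\ell_+$ is its cone of positive semidefinite matrices. For a set $D$ of diagonal positions, $\mathbb{S}^\ell(D)$ is the set of partial matrices $U$ with real entries $U_{ii}$ specified for $(i,i)\in D$ (other entries unspecified). Infima are taken in $\mathbb{R}\cup\{\pm\infty\}$ with $\inf\emptyset=+\infty$. An SDP in the variable $Y$ is called exact if, whenever it has an optimal solution, it has an optimal solution $Y$ with $\mathrm{rank}(Y)\le1$. *)

(* Defs.v *)
From mathcomp Require Import all_boot all_order all_algebra.
From mathcomp Require Import sesquilinear.
From mathcomp Require Import boolp classical_sets reals constructive_ereal ereal.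

Set Implicit Arguments.
Unset Strict Implicit.
Unset Printing Implicit Defensive.

Import Order.TTheory GRing.Theory Num.Theory.
Local Open Scope classical_set_scope.
Local Open Scope ring_scope.

Definition mxinner (R : realType) (l : nat) (A B : 'M[R]_l) : R :=
  \sum_(i < l) \sum_(j < l) A i j * B i j.

Definition psd_cone (R : realType) (l : nat) : set 'M[R]_l :=
  [set Y | Y \is symmetricmx /\
           forall x : 'cV[R]_l, 0 <= (x^T *m Y *m x) 0 0].

Definition conic_hull (R : realType) (l m : nat) (A : 'I_m -> 'M[R]_l) :
    set 'M[R]_l :=
  [set B | exists2 alpha : 'rV[R]_m,
             forall k, 0 <= alpha 0 k & B = \sum_(k < m) alpha 0 k *: A k].

(* Matrices with entries given only at the positions of D. *)
Definition partial_mx (R : realType) (l : nat) (D : {set 'I_l * 'I_l}) :=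
  {p : 'I_l * 'I_l | p \in D} -> R.

Definition sdp_feasible (R : realType) (l m : nat) (A : 'I_m -> 'M[R]_l)
    (D : {set 'I_l * 'I_l}) (delta : 'rV[R]_m) (U : partial_mx R D) :
    set 'M[R]_l :=
  [set Y | [/\ psd_cone Y,
               forall k, mxinner (A k) Y <= delta 0 k &
               forall p : {p : 'I_l * 'I_l | p \in D},
                 Y (val p).1 (val p).2 = U p]].

Definition sdp_value (R : realType) (l m : nat) (A0 : 'M[R]_l)
    (A : 'I_m -> 'M[R]_l) (D : {set 'I_l * 'I_l}) (delta : 'rV[R]_m)
    (U : partial_mx R D) : \bar R :=
  ereal_inf [set (mxinner A0 Y)%:E | Y in sdp_feasible A delta U].

Definition sdp_optimal (R : realType) (l m : nat) (A0 : 'M[R]_l)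
    (A : 'I_m -> 'M[R]_l) (D : {set 'I_l * 'I_l}) (delta : 'rV[R]_m)
    (U : partial_mx R D) : set 'M[R]_l :=
  [set Y | sdp_feasible A delta U Y /\
           (mxinner A0 Y)%:E = sdp_value A0 A delta U].

Definition sdp_exact (R : realType) (l m : nat) (A0 : 'M[R]_l)
    (A : 'I_m -> 'M[R]_l) (D : {set 'I_l * 'I_l}) (delta : 'rV[R]_m)
    (U : partial_mx R D) : Prop :=
  (exists Y, sdp_optimal A0 A delta U Y) ->
  exists2 Y, sdp_optimal A0 A delta U Y & (\rank Y <= 1)%N.

(* Main.v *)
Require Import Defs.
From mathcomp Require Import all_boot all_order all_algebra.
From mathcomp Require Import sesquilinear.
From mathcomp Require Import boolp classical_sets reals constructive_ereal ereal.

Set Implicit Arguments.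
Unset Strict Implicit.
Unset Printing Implicit Defensive.

Import Order.TTheory GRing.Theory Num.Theory.
Local Open Scope classical_set_scope.
Local Open Scope ring_scope.

(** The slack of the optimal solution is what has to be removed. Given an
    optimal solution Y* of the modified program, replace each of the first m
    right-hand sides by the value <A_k, Y*> attained there. Any Y feasible for
    this tightened program satisfies <A_k, Y> <= <A_k, Y*> for every k, hence
    <A_j, Y> <= <A_j, Y*> for every A_j in the cone of the A_k
    ([mxinner_conic_hull_le]): Y inherits from Y* all the constraints of the
    modified program, the added ones included. So the tightened program is a
    restriction of the modified one that still contains the minimizer Y*, and
    the two have the same finite value ([sdp_value_restrict]). The rank
    hypothesis therefore applies to it, and the minimizer of rank at most one
    that it provides is also a minimizer of the modified program. *)

Lemma mxinner_sumZl (R : realType) (l m : nat) (a : 'I_m -> R)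
    (A : 'I_m -> 'M[R]_l) (Y : 'M[R]_l) :
  mxinner (\sum_k a k *: A k) Y = \sum_k a k * mxinner (A k) Y.
Proof.
rewrite /mxinner; under [RHS]eq_bigr do rewrite mulr_sumr.
rewrite [RHS]exchange_big; apply: eq_bigr => i _ /=.
under [RHS]eq_bigr do rewrite mulr_sumr.
rewrite [RHS]exchange_big; apply: eq_bigr => j _ /=.
by rewrite summxE mulr_suml; apply: eq_bigr => k _; rewrite mxE mulrA.
Qed.

Lemma mxinner_conic_hull_le (R : realType) (l m : nat) (A : 'I_m -> 'M[R]_l)
    (B Y Z : 'M[R]_l) :
  conic_hull A B -> (forall k, mxinner (A k) Y <= mxinner (A k) Z) ->
  mxinner B Y <= mxinner B Z.
Proof.
move=> [a a_ge0 ->] leYZ; rewrite !mxinner_sumZl.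
by apply: ler_sum => k _; apply: ler_wpM2l.
Qed.

(** Shrinking the feasible set cannot lower the infimum, and keeping one
    minimizer prevents it from rising. *)
Lemma sdp_value_restrict (R : realType) (l m n : nat) (A0 : 'M[R]_l)
    (A : 'I_m -> 'M[R]_l) (B : 'I_n -> 'M[R]_l) (D : {set 'I_l * 'I_l})
    (delta : 'rV[R]_m) (gamma : 'rV[R]_n) (U : partial_mx R D) (Y : 'M[R]_l) :
  sdp_feasible B gamma U `<=` sdp_feasible A delta U ->
  sdp_optimal A0 A delta U Y -> sdp_feasible B gamma U Y ->
  sdp_value A0 B gamma U = sdp_value A0 A delta U.
Proof.
move=> subBA [_ Yopt] YB; apply/eqP; rewrite eq_le; apply/andP; split.
  by rewrite -Yopt; apply: ereal_inf_lbound; exists Y.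
by apply: le_ereal_inf; apply: image_subset.
Qed.

(* With 0-based ordinals, A k and delta 0 k stand for A_{k+1} and delta_{k+1};
   the indices k < m are those of the original program (S_delta), and
   m <= k < m' those of the added constraints. *)
Theorem theorem4p7 (R : realType) (l m m' : nat) (lt_mm' : (m < m')%N)
    (A0 : 'M[R]_l) (A : 'I_m' -> 'M[R]_l)
    (A0_sym : A0 \is symmetricmx) (A_sym : forall k, A k \is symmetricmx)
    (D : {set 'I_l * 'I_l}) (D_diag : forall p, p \in D -> p.1 = p.2)
    (U : partial_mx R D)
    (A_init := fun k : 'I_m => A (widen_ord (ltnW lt_mm') k))
    (rank1 : forall delta' : 'rV[R]_m,
       (-oo < sdp_value A0 A_init delta' U < +oo)%E ->
       exists2 Y, sdp_optimal A0 A_init delta' U Y & (\rank Y <= 1)%N)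
    (delta : 'rV[R]_m')
    (A_cone : forall j : 'I_m', (m <= j)%N -> conic_hull A_init (A j)) :
  sdp_exact A0 A delta U.
Proof.
move=> [Y Yopt]; have [[Ypsd Yle YU] Yval] := Yopt.
pose gamma : 'rV[R]_m := \row_k mxinner (A_init k) Y.
have Ygamma : sdp_feasible A_init gamma U Y by split=> // k; rewrite mxE.
have sub_feas : sdp_feasible A_init gamma U `<=` sdp_feasible A delta U.
  move=> Z [Zpsd Zle ZU]; split=> // j.
  have ZleY k : mxinner (A_init k) Z <= mxinner (A_init k) Y.
    by have := Zle k; rewrite mxE.
  apply: le_trans (Yle j); have [le_mj|lt_jm] := leqP m j.
    exact: mxinner_conic_hull_le (A_cone j le_mj) ZleY.
  suff -> : A j = A_init (Ordinal lt_jm) by [].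
  by congr A; apply: val_inj.
have eq_val := sdp_value_restrict sub_feas Yopt Ygamma.
have [|Z [Zfeas Zval] rkZ] := rank1 gamma.
  by rewrite eq_val -Yval ltNyr ltry.
by exists Z => //; split; [exact: sub_feas | rewrite Zval].
Qed.
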